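(* Let $F$ be a CNF formula, let $\ell$ be a literal of $F$, and suppose there is a symmetry $\sigma\in\mathrm{Aut}(F)$ with $\sigma(\ell)=\overline\ell$ (negation fixing). Then: (1) $F$ and $F\wedge\{\ell\}$ are equisatisfiable; (2) the unit clause $\{\ell\}$ is substitution redundant (SR) for $F$.
   Context: A literal is a variable $v$ or its negation $\overline v$; a clause is a set (disjunction) of literals; a CNF formula is a set (conjunction) of clauses. Two formulas are equisatisfiable if one is satisfiable iff the other is. A (syntactic) symmetry of $F$ is a permutation $\sigma$ of the literals of $F$ such that $\sigma(F)=F$ (relabeling literals by $\sigma$ yields the same set of clauses) and $\sigma(\overline\ell)=\overline{\sigma(\ell)}$ for all literals $\ell$; $\mathrm{Aut}(F)$ is the group of symmetries. A substitution is a map $\omega$ from the variables of $F$ to literals of $F$ or the constants $\top,\bot$, extended to literals by $\omega(\overline v)=\overline{\omega(v)}$ (with $\overline\top=\bot$). For a formula $G$, $G_{|\omega}$ replaces each literal $\ell$ by $\omega(\ell)$, deleting clauses containing $\top$ and occurrences of $\bot$. $\neg C:=\bigwedge_{\ell\in C}\overline\ell$. $G\vdash_1\bot$ means unit propagation on $G$ yields a conflict; $G\vdash_1 D$ for a clause $D$ means $G\wedge\neg D\vdash_1\bot$; $G\vdash_1 H$ means $G\vdash_1 D$ for all $D\in H$. A clause $C$ is substitution redundant (SR) for $G$ if there is a substitution $\omega$ with $G\wedge\neg C\vdash_1(G\wedge C)_{|\omega}$. *)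

(* Defs.v *)
From HB Require Import structures.
From mathcomp Require Import all_boot.
From mathcomp Require Import fingroup perm.
From mathcomp Require Import finmap.

Set Implicit Arguments.
Unset Strict Implicit.
Unset Printing Implicit Defensive.

Local Open Scope fset_scope.

(* (v, true) is the literal v and (v, false) is its negation. *)
Definition literal (V : choiceType) : choiceType := (V * bool)%type.
Definition clause (V : choiceType) : choiceType := {fset literal V}.
Definition cnf (V : choiceType) : choiceType := {fset clause V}.

Definition neg (V : choiceType) (l : literal V) : literal V := (l.1, ~~ l.2).

Definition true_lit (V : choiceType) (t : V -> bool) (l : literal V) : bool :=
  t l.1 == l.2.

Definition satisfiable (V : choiceType) (F : cnf V) : Prop :=
  exists t : V -> bool,
    forall C : clause V, C \in F -> exists2 l, l \in C & true_lit t l.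

Definition equisatisfiable (V : choiceType) (F G : cnf V) : Prop :=
  satisfiable F <-> satisfiable G.

Definition vars (V : choiceType) (F : cnf V) : {fset V} :=
  [fset l.1 | C in F, l in (C : {fset literal V})].

(* Both literals of every variable of F, whether or not both occur in F. *)
Definition lits (V : choiceType) (F : cnf V) : {fset literal V} :=
  vars F `*` [fset true; false].

Lemma neg_lits (V : choiceType) (F : cnf V) (l : literal V) :
  l \in lits F -> neg l \in lits F.
Proof.
by rewrite !inE /= => /andP[-> _]; case: (l.2).
Qed.

Definition negl (V : choiceType) (F : cnf V) (l : lits F) : lits F :=
  [` neg_lits (valP l)].

(* A permutation of the literals of F, extended by the identity. *)
Definition ext (V : choiceType) (F : cnf V) (s : {perm lits F})
    (l : literal V) : literal V :=
  if insub l is Some k then val (s k) else l.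

Definition relabel (V : choiceType) (f : literal V -> literal V) (F : cnf V) :
    cnf V :=
  [fset [fset f l | l in (C : {fset literal V})] | C in F].

Definition symmetries (V : choiceType) (F : cnf V) : {set {perm lits F}} :=
  [set s : {perm lits F} |
    (relabel (ext s) F == F) && [forall l, s (negl l) == negl (s l)]].

Lemma ext1 (V : choiceType) (F : cnf V) : ext (1%g : {perm lits F}) =1 id.
Proof. by move=> l; rewrite /ext; case: insubP => //= k _ <-; rewrite perm1. Qed.

Lemma extM (V : choiceType) (F : cnf V) (s t : {perm lits F}) :
  ext (s * t)%g =1 ext t \o ext s.
Proof.
move=> l; rewrite /ext /=; case: insubP => /= [k _ _|lF].
  by rewrite valK permM.
by rewrite insubN.
Qed.

Lemma relabel_id (V : choiceType) (f : literal V -> literal V) (F : cnf V) :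
  f =1 id -> relabel f F = F.
Proof.
move=> f1.
have fC (C : clause V) : [fset f l | l in (C : {fset literal V})] = C.
  apply/fsetP => l; apply/imfsetP/idP => [[k /= kC ->]|lC]; first by rewrite f1.
  by exists l; rewrite ?f1.
apply/fsetP => C; apply/imfsetP/idP => [[D /= DF ->]|CF]; first by rewrite fC.
by exists C; rewrite ?fC.
Qed.

Lemma relabel_comp (V : choiceType) (f g h : literal V -> literal V)
    (F : cnf V) :
  h =1 g \o f -> relabel h F = relabel g (relabel f F).
Proof.
move=> hE.
have hC (C : clause V) : [fset h l | l in (C : {fset literal V})] =
    [fset g l | l in [fset f k | k in (C : {fset literal V})]].
  apply/fsetP => m; apply/imfsetP/imfsetP => /= [[k kC ->]|[k /imfsetP[/= i iC ->] ->]].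
    by exists (f k); [apply/imfsetP; exists k | rewrite hE].
  by exists i; rewrite ?hE.
apply/fsetP => D; apply/imfsetP/imfsetP => /= [[C CF ->]|[C /imfsetP[/= B BF ->] ->]].
  by exists [fset f k | k in (C : {fset literal V})]; [apply/imfsetP; exists C | rewrite hC].
by exists B; rewrite ?hC.
Qed.

Lemma symmetries_group_set (V : choiceType) (F : cnf V) :
  group_set (symmetries F).
Proof.
apply/group_setP; split=> [|s t].
  rewrite inE relabel_id ?eqxx /=; last exact: ext1.
  by apply/forallP => l; rewrite !perm1.
rewrite !inE => /andP[/eqP sF /forallP sN] /andP[/eqP tF /forallP tN].
rewrite (relabel_comp _ (extM s t)) sF tF eqxx /=.
by apply/forallP => l; rewrite !permM (eqP (sN l)) (eqP (tN _)).
Qed.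

Definition Aut (V : choiceType) (F : cnf V) : {group {perm lits F}} :=
  group (symmetries_group_set F).

(* inl b is the constant true or false, inr l is the literal l. *)
Definition xlit (V : choiceType) : choiceType := (bool + literal V)%type.

Definition xneg (V : choiceType) (x : xlit V) : xlit V :=
  match x with inl b => inl (~~ b) | inr l => inr (neg l) end.

Definition subst_lit (V : choiceType) (w : V -> xlit V) (l : literal V) :
    xlit V :=
  if l.2 then w l.1 else xneg (w l.1).

(* Only the values of w on the variables of G matter. *)
Definition substitution_of (V : choiceType) (G : cnf V) (w : V -> xlit V) :
    Prop :=
  forall v : V, v \in vars G -> if w v is inr l then l \in lits G : Prop else True.

Definition restrict_clause (V : choiceType) (w : V -> xlit V) (C : clause V) :
    clause V :=
  [fset m in pmap (fun l => if subst_lit w l is inr m then Some m else None)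
                  (C : {fset literal V})].

Definition restrict (V : choiceType) (w : V -> xlit V) (G : cnf V) : cnf V :=
  [fset restrict_clause w C | C in G
     & ~~ has (fun l => subst_lit w l == inl true) (C : {fset literal V})].

Definition conj_clause (V : choiceType) (G : cnf V) (C : clause V) : cnf V :=
  C |` G.

Definition neg_clause (V : choiceType) (C : clause V) : cnf V :=
  [fset [fset neg l] | l in (C : {fset literal V})].

(* The partial assignment making l true and fixing no other variable. *)
Definition assign (V : choiceType) (l : literal V) : V -> xlit V :=
  fun v => if v == l.1 then inl l.2 else inr (v, true).

Inductive up_conflict (V : choiceType) (G : cnf V) : Prop :=
| up_empty of fset0 \in G
| up_unit (l : literal V) of
    [fset l] \in G & up_conflict (restrict (assign l) G).

Definition up_clause (V : choiceType) (G : cnf V) (D : clause V) : Prop :=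
  up_conflict (G `|` neg_clause D).

Definition up_cnf (V : choiceType) (G H : cnf V) : Prop :=
  forall D : clause V, D \in H -> up_clause G D.

(* The substitution acts on the variables, and into the literals, of G and C. *)
Definition SR (V : choiceType) (G : cnf V) (C : clause V) : Prop :=
  exists2 w : V -> xlit V, substitution_of (conj_clause G C) w &
    up_cnf (G `|` neg_clause C) (restrict w (conj_clause G C)).

(* Main.v *)
Require Import Defs.
From mathcomp Require Import all_boot.
From mathcomp Require Import fingroup perm.
From mathcomp Require Import finmap.

Set Implicit Arguments.
Unset Strict Implicit.

Local Open Scope fset_scope.

(* If a model of F falsifies l, composing it with the symmetry gives a model
   of F that satisfies l, since l is mapped to its negation. Used as a
   substitution, the symmetry maps F and {l} to F and {neg l}, and every clause
   of the result already occurs among the premises F and neg l: unit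
   propagation derives each clause of a formula from that formula. *)

Lemma negK (V : choiceType) : involutive (@neg V).
Proof. by case=> v b; rewrite /neg /= negbK. Qed.

Lemma true_lit_neg (V : choiceType) (t : V -> bool) (k : literal V) :
  true_lit t (neg k) = ~~ true_lit t k.
Proof. by rewrite /true_lit /=; case: (t _) k.2 => [] []. Qed.

Lemma ext_val (V : choiceType) (F : cnf V) (s : {perm lits F}) (k : lits F) :
  ext s (val k) = val (s k).
Proof. by rewrite /ext valK. Qed.

(** On [lits F] this is the second condition on a symmetry. Elsewhere [ext s] is the identity, and
    since [lits F] is closed under negation, [k] and [neg k] lie outside it together. *)
Lemma ext_neg (V : choiceType) (F : cnf V) (s : {perm lits F}) (k : literal V) :
  s \in Aut F -> ext s (neg k) = neg (ext s k).
Proof.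
rewrite inE => /andP[_ /forallP sN].
case kF: (k \in lits F).
  have -> : neg k = val (negl [` kF]) by [].
  by rewrite ext_val (eqP (sN _)) -[k in RHS]/(val [` kF]) ext_val.
rewrite /ext !insubN ?kF //.
by apply/negP => /neg_lits; rewrite negK kF.
Qed.

Lemma relabel_Aut (V : choiceType) (F : cnf V) (s : {perm lits F}) :
  s \in Aut F -> relabel (ext s) F = F.
Proof. by rewrite inE => /andP[/eqP]. Qed.

Lemma satisfiable_conj_lit (V : choiceType) (F : cnf V) (s : {perm lits F})
    (l : lits F) :
  s \in Aut F -> s l = negl l ->
  satisfiable F -> satisfiable (conj_clause F [fset val l]).
Proof.
move=> sF sl [t tF]; case tl: (true_lit t (val l)).
  exists t => C; rewrite inE => /orP[|/tF //].
  by rewrite inE => /eqP ->; exists (val l); rewrite ?inE.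
(* The pullback of [t] along the symmetry, prescribed on positive literals; [ext_neg] carries it
   over to negative ones. *)
pose t' v := true_lit t (ext s (v, true)).
have t'E k : true_lit t' k = true_lit t (ext s k).
  case: k => v [] /=; first by rewrite /true_lit /= eqb_id.
  rewrite -[(v, false)]/(neg (v, true)) true_lit_neg ext_neg // true_lit_neg.
  by rewrite {1}/true_lit /= eqb_id.
exists t' => C; rewrite inE => /orP[|CF].
  rewrite inE => /eqP ->; exists (val l); rewrite ?inE //.
  by rewrite t'E ext_val sl true_lit_neg tl.
(* The image of [C] is again a clause of [F], so [t] satisfies [ext s k] for some [k] in [C], which
   means that [t'] satisfies [k]. *)
have /tF[m /imfsetP[/= k kC ->] tk] :
    [fset ext s k | k in (C : {fset literal V})] \in F.
  by rewrite -{2}(relabel_Aut sF); apply/imfsetP; exists C.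
by exists k; rewrite ?t'E.
Qed.

Lemma subst_lit_assign (V : choiceType) (k m : literal V) :
  subst_lit (assign k) m =
  if m.1 == k.1 then inl (m.2 == k.2) else inr m.
Proof.
case: m => v b; rewrite /subst_lit /assign /=.
by case: eqP => _; case: b; case: k.2.
Qed.

Lemma restrict_clause_assign (V : choiceType) (k : literal V) (C : clause V) :
  restrict_clause (assign k) C = [fset m in C | m.1 != k.1].
Proof.
apply/fsetP => m; rewrite !inE /= mem_pmap; apply/mapP/andP => [[i iC]|[mC mk]].
  by rewrite subst_lit_assign; case: ifPn => // ik [->].
by exists m; rewrite ?subst_lit_assign ?(negPf mk).
Qed.

(** Only [k] itself becomes true under [assign k], so a clause without [k] is not deleted; it can
    lose at most [neg k]. *)
Lemma mem_restrict_assign (V : choiceType) (k : literal V) (C : clause V)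
    (G : cnf V) :
  C \in G -> k \notin C -> [fset m in C | m.1 != k.1] \in restrict (assign k) G.
Proof.
move=> CG kC; apply/imfsetP; exists C; last by rewrite restrict_clause_assign.
rewrite !inE CG /=; apply/hasPn => m mC; rewrite subst_lit_assign.
case: ifP => // /eqP m1; apply: contra kC => /eqP[/eqP m2].
by have <- : m = k by case: m k m1 m2 {mC} => ? ? [? ?] /= -> ->.
Qed.

(** Induction on the size of [D]: propagating the unit [neg k] for some [k] in [D] strictly shrinks
    [D], and the units for its remaining literals survive, until [D] becomes the empty clause. *)
Lemma up_conflict_falsified (V : choiceType) (G : cnf V) (D : clause V) :
  D \in G -> (forall k, k \in D -> [fset neg k] \in G) -> up_conflict G.
Proof.
have [n] := ubnP #|` D|; elim: n G D => // n IHn G D; rewrite ltnS => Dn DG DN.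
have [D0|[k kD]] := fset_0Vmem D; first by apply: up_empty; rewrite -D0.
apply: (@up_unit _ _ (neg k)); first exact: DN.
have [NkD|NkD] := boolP (neg k \in D).
  (* D is a tautology: k and neg k are both units of G. *)
  apply: up_empty; have := DN _ NkD; rewrite negK => kG.
  have -> : fset0 = [fset m in [fset k] | m.1 != (neg k).1] :> clause V.
    by apply/fsetP => m; rewrite !inE; case: eqP => // ->; rewrite /= eqxx.
  apply: mem_restrict_assign => //; rewrite inE.
  by case: (k) => v [] /=; rewrite /neg xpair_eqE andbF.
apply: IHn (mem_restrict_assign DG NkD) _.
  apply: leq_trans Dn; apply: fproper_ltn_card; rewrite fproperE.
  apply/andP; split; first by apply/fsubsetP => m; rewrite !inE => /andP[].
  by apply/fsubsetPn; exists k; rewrite // !inE eqxx andbF.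
move=> m; rewrite !inE /= => /andP[mD mk].
(* The variable of [m] differs from that of [k], so the restriction leaves this unit unchanged. *)
have -> : [fset neg m] =
    [fset i in [fset neg m] | i.1 != (neg k).1] :> clause V.
  by apply/fsetP => i; rewrite !inE; case: eqP => // ->; rewrite /= mk.
apply: mem_restrict_assign; first exact: DN.
by rewrite inE; apply: contra mk => /eqP /(can_inj (@negK V)) ->.
Qed.

Lemma up_clause_mem (V : choiceType) (G : cnf V) (D : clause V) :
  D \in G -> up_clause G D.
Proof.
move=> DG; apply: (@up_conflict_falsified _ _ D); first by rewrite inE DG.
by move=> k kD; rewrite inE; apply/orP; right; apply/imfsetP; exists k.
Qed.

(** A substitution without constants satisfies no clause and drops no literal, so it merely
    renames. *)
Lemma restrict_lits (V : choiceType) (w : V -> xlit V)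
    (f : literal V -> literal V) (G : cnf V) :
  (forall k, subst_lit w k = inr (f k)) -> restrict w G = relabel f G.
Proof.
move=> wf.
have wC (C : clause V) :
    restrict_clause w C = [fset f k | k in (C : {fset literal V})].
  apply/fsetP => m; rewrite !inE /= mem_pmap.
  apply/mapP/imfsetP => /= [[k kC]|[k kC ->]].
    by rewrite wf => -[->]; exists k.
  by exists k; rewrite ?wf.
apply/fsetP => D; apply/imfsetP/imfsetP => /= [[C]|[C CG ->]].
  by rewrite inE wC => /andP[CG _] ->; exists C.
exists C; rewrite ?wC // inE CG /=.
by apply/hasPn => k _; rewrite wf.
Qed.

Lemma vars_lits (V : choiceType) (F : cnf V) (k : literal V) :
  (k \in lits F) = (k.1 \in vars F).
Proof. by rewrite !inE /=; case: k.2; rewrite andbT. Qed.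

Lemma vars_conj_lit (V : choiceType) (F : cnf V) (k : literal V) :
  k \in lits F -> vars (conj_clause F [fset k]) = vars F.
Proof.
rewrite vars_lits => kF; apply/fsetP => v; apply/idP/idP.
  case/imfset2P => /= C; rewrite !inE => /orP[/eqP ->|CF] [m mC ->].
    by move: mC; rewrite inE => /eqP ->.
  by apply/imfset2P; exists C => //; exists m.
case/imfset2P => /= C CF [m mC ->].
by apply/imfset2P; exists C; rewrite ?inE ?CF ?orbT //; exists m.
Qed.

Lemma SR_lit (V : choiceType) (F : cnf V) (s : {perm lits F}) (l : lits F) :
  s \in Aut F -> s l = negl l -> SR F [fset val l].
Proof.
move=> sF sl; pose w v : xlit V := inr (ext s (v, true)).
have wE k : subst_lit w k = inr (ext s k).
  by case: k => v [] //; rewrite -[(v, false)]/(neg (v, true)) ext_neg.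
exists w => [v|D].
  rewrite vars_conj_lit ?(valP l) // => vF /=.
  have vlF : (v, true) \in lits F by rewrite vars_lits.
  rewrite /lits vars_conj_lit ?(valP l) //.
  by rewrite -[(v, true)]/(val [` vlF]) ext_val; apply: valP.
rewrite (restrict_lits _ wE) => /imfsetP[/= C CG ->]; apply: up_clause_mem.
(* The image of the added unit is the unit [neg l], found in [neg_clause]; the image of a clause of
   [F] is found in [F]. *)
move: CG; rewrite !inE => /orP[/eqP ->|CF]; apply/orP; [right|left].
  apply/imfsetP; exists (val l); rewrite ?inE //.
  apply/fsetP => m; rewrite inE; apply/imfsetP/eqP => /= [[k]|->].
    by rewrite inE => /eqP -> ->; rewrite ext_val sl.
  by exists (val l); rewrite ?inE // ext_val sl.
by rewrite -{2}(relabel_Aut sF); apply/imfsetP; exists C.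
Qed.

Theorem theorem3 (V : choiceType) (F : cnf V) (l : lits F)
    (h : exists2 s : {perm lits F}, s \in Aut F & s l = negl l) :
  equisatisfiable F (conj_clause F [fset val l]) /\ SR F [fset val l].
Proof.
case: h => s sF sl; split; last exact: SR_lit sF sl.
split; first exact: satisfiable_conj_lit sF sl.
by case=> t tF; exists t => C CF; apply: tF; rewrite inE CF orbT.
Qed.
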